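(* For every $n\ge 3$, let $K^*_n$ be the complete graph on $n$ vertices with a loop added at every vertex. In the edge-distinguishing game (EDGe) played on $K^*_n$ (with $\lambda(K^*_n)$ colors), Player 2 has a winning strategy if $n$ is even, and Player 1 has a winning strategy if $n$ is odd.
   Context: For a graph $G$ (here possibly with loops) and a positive integer $k$, a $k$-coloring $c:V(G)\to[k]=\{1,\dots,k\}$ induces the edge coloring $c'(\{u,v\})=\{c(u),c(v)\}$ (a multiset; a loop at $v$ receives $\{c(v),c(v)\}$). $c$ is edge-distinguishing if $c'$ is injective on the edges (including loops), and $\lambda(G)$ is the least $k$ admitting such a coloring. A partial coloring on $U\subseteq V(G)$ has partial induced edge coloring on the edges (including loops) with all endpoints in $U$. EDGe on $G$: two players, Player 1 first, alternately color an uncolored vertex with a color from $[\lambda(G)]$; a move is legal iff afterwards the partial induced edge coloring of the colored vertices is injective. The player making the last legal move wins. A winning strategy guarantees a win regardless of the opponent's play. *)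

(* Defs.v *)
From mathcomp Require Import all_boot.
From mathcomp Require Import finmap multiset.

Set Implicit Arguments.
Unset Strict Implicit.
Unset Printing Implicit Defensive.

(* A finite graph in which loops, [adj v v], are allowed; the edge joining u
   and v is the set [set u; v], a singleton when it is a loop. *)
Record loop_graph := LoopGraph {
  vertex :> finType;
  adj : rel vertex;
  adj_sym : symmetric adj
}.

Definition complete_graph (n : nat) : loop_graph :=
  @LoopGraph 'I_n (fun u v => u != v)
    (fun u v => congr1 negb (eq_sym u v)).

Lemma add_loops_sym (G : loop_graph) :
  symmetric (fun u v : G => adj u v || (u == v)).
Proof. by move=> u v; rewrite adj_sym eq_sym. Qed.

Definition add_loops (G : loop_graph) : loop_graph :=
  LoopGraph (@add_loops_sym G).

Definition Kstar (n : nat) : loop_graph := add_loops (complete_graph n).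

Section Coloring.
Variable G : loop_graph.

Definition edge_color k (c : G -> 'I_k) (u v : G) : {mset 'I_k}%mset :=
  [mset c u; c v]%mset.

Definition edge_distinguishing k (c : G -> 'I_k) : bool :=
  [forall u, forall v, forall x, forall y,
    [&& adj u v, adj x y & edge_color c u v == edge_color c x y]
      ==> ([set u; v] == [set x; y])].

Definition edge_distinguishable k : bool :=
  (0 < k) && [exists c : {ffun G -> 'I_k}, edge_distinguishing c].

Lemma ex_edge_distinguishable : exists k, edge_distinguishable k.
Proof.
exists #|G|.+1; apply/andP; split=> //; apply/existsP.
pose f (v : G) : 'I_#|G|.+1 := widen_ord (leqnSn _) (enum_rank v).
have f_inj : injective f by move=> u v [] /ord_inj/enum_rank_inj.
exists [ffun v => f v]; do 4!apply/forallP => ?; apply/implyP.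
case/and3P=> _ _ /eqP/msetP E; apply/eqP/setP => z.
move: (E (f z)); rewrite /edge_color !ffunE !msetE2 !msetnE !(inj_eq f_inj) !inE.
by do 4!case: (z == _).
Qed.

(* The number lambda(G). *)
Definition edge_dist_number : nat := ex_minn ex_edge_distinguishable.

(* A partial coloring; [None] marks an uncolored vertex. *)
Definition partial_coloring k := {ffun G -> option 'I_k}.

Definition partial_edge_color k (p : partial_coloring k) (u v : G) :
    option {mset 'I_k}%mset :=
  if (p u, p v) is (Some a, Some b) then Some [mset a; b]%mset else None.

Definition partial_edge_distinguishing k (p : partial_coloring k) : bool :=
  [forall u, forall v, forall x, forall y,
    [&& adj u v, adj x y, partial_edge_color p u v != None
      & partial_edge_color p u v == partial_edge_color p x y]
      ==> ([set u; v] == [set x; y])].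

End Coloring.

Inductive player := Player1 | Player2.

Section Game.
Variables (G : loop_graph) (k : nat).

Definition move : Type := G * 'I_k.

Definition uncolored : partial_coloring G k := [ffun=> None].

Definition play_move (p : partial_coloring G k) (m : move) :
    partial_coloring G k :=
  [ffun v => if v == m.1 then Some m.2 else p v].

Definition legal_move (p : partial_coloring G k) (m : move) : bool :=
  (p m.1 == None) && partial_edge_distinguishing (play_move p m).

(* Histories list the moves in the order in which they are played. *)
Definition position (h : seq move) : partial_coloring G k :=
  foldl play_move uncolored h.

Definition to_move (h : seq move) : player :=
  if odd (size h) then Player2 else Player1.

Definition legal_play (h : seq move) : Prop :=
  forall h1 m h2, h = h1 ++ m :: h2 -> legal_move (position h1) m.

Definition game_over (h : seq move) : Prop :=
  forall m, ~~ legal_move (position h) m.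

(* The player who made the last move of h, if any move was made. *)
Definition last_mover (h : seq move) : option player :=
  if h is [::] then None
  else Some (if odd (size h) then Player1 else Player2).

Definition strategy := seq move -> option move.

Definition valid_strategy (P : player) (s : strategy) : Prop :=
  forall h, legal_play h -> to_move h = P -> ~ game_over h ->
    exists2 m, s h = Some m & legal_move (position h) m.

Definition follows (P : player) (s : strategy) (h : seq move) : Prop :=
  forall h1 m h2, h = h1 ++ m :: h2 -> to_move h1 = P -> s h1 = Some m.

Definition winning_strategy (P : player) (s : strategy) : Prop :=
  valid_strategy P s /\
  forall h, legal_play h -> game_over h -> follows P s h ->
    last_mover h = Some P.

End Game.

Definition EDGe_has_winning_strategy (G : loop_graph) (P : player) : Prop :=
  exists s : strategy G (edge_dist_number G), winning_strategy P s.

(* Main.v *)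
Require Import Defs.
From mathcomp Require Import all_boot.
From mathcomp Require Import finmap multiset.

Set Implicit Arguments.
Unset Strict Implicit.
Unset Printing Implicit Defensive.

(** When every vertex carries a loop, two vertices of the same color give two
    loops of the same color, so a partial coloring is edge-distinguishing exactly
    when it is injective on the colored vertices.  At least as many colors as
    vertices are therefore available, so a position with an uncolored vertex always
    has a legal move.  Hence every play colors all the vertices, however the
    players move, and the parity of their number decides the winner. *)

Definition partial_injective (G : loop_graph) k (p : partial_coloring G k) :=
  forall u v a, p u = Some a -> p v = Some a -> u = v.

(** Under injectivity a colored vertex lies on an edge exactly when its color occurs in the multiset
    of that edge, so the multiset determines the edge. *)
Lemma partial_injective_edge_distinguishing (G : loop_graph) k
    (p : partial_coloring G k) :
  partial_injective p -> partial_edge_distinguishing p.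
Proof.
move=> p_inj; apply/forallP=> u; apply/forallP=> v; apply/forallP=> x.
apply/forallP=> y; apply/implyP => /and4P[_ _]; rewrite /partial_edge_color.
case pu: (p u) => [a|//]; case pv: (p v) => [b|//] _.
case px: (p x) => [c|//]; case py: (p y) => [d|//] /eqP[] /msetP colE.
apply/eqP/setP => z; rewrite !inE.
case pz: (p z) => [e|]; last first.
  (* An uncolored [z] differs from the four colored endpoints, so it lies on neither edge. *)
  by do 4![case: eqP => [z_eq|_]; first by rewrite z_eq ?pu ?pv ?px ?py in pz].
have eq_col w f : p w = Some f -> (z == w) = (e == f).
  move=> pw; apply/eqP/eqP => [zw|ef]; first by move: pz; rewrite zw pw => -[].
  by apply: (p_inj _ _ e) => //; rewrite ef.
(* The color [e] of [z] has the same multiplicity in both multisets; positive multiplicity means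
   that [z] is an endpoint. *)
move: (colE e); rewrite !msetE2 !msetnE.
rewrite (eq_col u a) // (eq_col v b) // (eq_col x c) // (eq_col y d) //.
by do 4!case: (e == _).
Qed.

Lemma partial_edge_distinguishingP (G : loop_graph) k (p : partial_coloring G k) :
  reflexive (@adj G) ->
  reflect (partial_injective p) (partial_edge_distinguishing p).
Proof.
move=> adjxx; apply: (iffP idP); last exact: partial_injective_edge_distinguishing.
move=> /forallP p_ed u v a pu pv.
(* The two edges compared are the loops at [u] and at [v]. *)
move: (p_ed u) => /forallP/(_ u)/forallP/(_ v)/forallP/(_ v).
rewrite !adjxx /partial_edge_color pu pv eqxx /= => /eqP/setP/(_ u).
by rewrite !inE eqxx /= orbb => /esym/eqP.
Qed.

Lemma edge_dist_number_ge (G : loop_graph) :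
  reflexive (@adj G) -> #|G| <= edge_dist_number G.
Proof.
move=> adjxx; rewrite /edge_dist_number.
case: ex_minnP => k /andP[_ /existsP[c /forallP c_ed]] _.
rewrite -[k]card_ord; apply: (@leq_card _ _ c) => u v cuv.
move: (c_ed u) => /forallP/(_ u)/forallP/(_ v)/forallP/(_ v).
rewrite !adjxx /edge_color cuv eqxx /= => /eqP/setP/(_ u).
by rewrite !inE eqxx /= orbb => /esym/eqP.
Qed.

Lemma legal_play_rcons (G : loop_graph) k (h : seq (move G k)) m :
  legal_play (rcons h m) -> legal_play h /\ legal_move (position h) m.
Proof.
move=> leg; split; last by apply: (leg h m [::]); rewrite cats1.
by move=> h1 m1 h2 hE; apply: (leg h1 m1 (rcons h2 m)); rewrite hE rcons_cat.
Qed.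

Lemma position_rcons (G : loop_graph) k (h : seq (move G k)) m :
  position (rcons h m) = play_move (position h) m.
Proof. by rewrite /position -cats1 foldl_cat. Qed.

(** Each legal move colors a vertex that was uncolored, so it raises the count by exactly one. *)
Lemma card_colored (G : loop_graph) k (h : seq (move G k)) :
  legal_play h -> #|[set v | position h v != None]| = size h.
Proof.
elim/last_ind: h => [|h m IH].
  move=> _; apply/eqP; rewrite cards_eq0; apply/eqP/setP => v.
  by rewrite !inE ffunE.
case/legal_play_rcons=> /IH card_h /andP[m_free _].
rewrite size_rcons -card_h position_rcons.
have -> : [set v | play_move (position h) m v != None]
          = m.1 |: [set v | position h v != None].
  by apply/setP => v; rewrite !inE ffunE; case: (v == m.1).
by rewrite cardsU1 inE m_free.
Qed.

(** No induction is involved: the legality of the last move constrains the whole position. *)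
Lemma legal_play_partial_injective (G : loop_graph) k (h : seq (move G k)) :
  reflexive (@adj G) -> legal_play h -> partial_injective (position h).
Proof.
move=> adjxx; case/lastP: h => [_ u v a|h m]; first by rewrite ffunE.
case/legal_play_rcons=> _ /andP[_]; rewrite position_rcons.
by move/(partial_edge_distinguishingP _ adjxx).
Qed.

Lemma ex_unused_color (G : loop_graph) k (p : partial_coloring G k) :
  #|[set v | p v != None]| < k -> exists a, forall v, p v != Some a.
Proof.
set A := [set v | _] => A_lt.
(* The [k] values [Some a] cannot all lie in the image of fewer than [k] colored vertices. *)
have /subsetPn[_ /imsetP[a _ ->] aA] : ~~ (Some @: [set: 'I_k] \subset p @: A).
  apply: contraL A_lt => /subset_leq_card.
  rewrite card_imset; last exact: Some_inj.
  by rewrite cardsT card_ord -leqNgt => /leq_trans; apply; apply: leq_imset_card.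
exists a => v; apply: contra aA => /eqP pv.
by apply/imsetP; exists v; rewrite ?inE pv.
Qed.

Lemma legal_move_unused_color (G : loop_graph) k (p : partial_coloring G k) v a :
  partial_injective p -> p v = None -> (forall u, p u != Some a) ->
  legal_move p (v, a).
Proof.
move=> p_inj pv a_new; rewrite /legal_move pv eqxx /=.
apply: partial_injective_edge_distinguishing => x y b; rewrite !ffunE /=.
case: eqP => [->|_]; case: eqP => [->|_] //.
- by move=> [<-] /eqP; rewrite (negPf (a_new y)).
- by move=> /eqP px [ab]; rewrite -ab (negPf (a_new x)) in px.
- exact: p_inj.
Qed.

Lemma size_game_over (G : loop_graph) k (h : seq (move G k)) :
  reflexive (@adj G) -> #|G| <= k -> legal_play h -> game_over h ->
  size h = #|G|.
Proof.
move=> adjxx Gk leg over; rewrite -(card_colored leg) -cardsT.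
congr #|pred_of_set _|; apply/eqP; rewrite eqEsubset subsetT /=.
apply/negPn/negP => /subsetPn[v _]; rewrite inE negbK => /eqP pv.
have /ex_unused_color[a a_new] : #|[set u | position h u != None]| < k.
  apply: leq_trans Gk; rewrite -cardsT; apply: proper_card; rewrite properT.
  by apply/eqP => /setP/(_ v); rewrite !inE pv eqxx.
have := legal_move_unused_color (legal_play_partial_injective adjxx leg) pv a_new.
by rewrite (negPf (over _)).
Qed.

Lemma reflexive_winning_strategy (G : loop_graph) :
  reflexive (@adj G) -> 0 < #|G| ->
  EDGe_has_winning_strategy G (if odd #|G| then Player1 else Player2).
Proof.
move=> adjxx G_gt0.
(* Any legal move will do, since all complete plays have the same length. *)
exists (fun h => [pick m | legal_move (position h) m]); split=> [h _ _ not_over|].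
  case: pickP => [m m_legal|no_legal]; first by exists m.
  by case: not_over => m; rewrite no_legal.
move=> h leg over _.
(* Rewriting [#|G|] as [size h] reduces the claim to the definition of [last_mover]; positivity
   excludes the empty play, which has no last mover. *)
move: G_gt0; rewrite -(size_game_over adjxx (edge_dist_number_ge adjxx) leg over).
by case: h {leg over}.
Qed.

Theorem theorem4p1 (n : nat) (hn : 3 <= n) :
  (~~ odd n -> EDGe_has_winning_strategy (Kstar n) Player2) /\
  (odd n -> EDGe_has_winning_strategy (Kstar n) Player1).
Proof.
have adjxx : reflexive (@adj (Kstar n)) by move=> v /=; rewrite eqxx orbT.
have cardK : #|Kstar n| = n by apply: card_ord.
have := reflexive_winning_strategy adjxx; rewrite cardK => win.
have {}win := win (leq_trans (isT : 0 < 3) hn).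
by split=> [/negPf n_odd|n_odd]; rewrite n_odd in win.
Qed.
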